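(* Let $h\ge2$ be an integer, let $\{G_n\}_{n\ge1}$ be a sequence of finite digraphs with $|V(G_n)|\to\infty$, let $v_n^\ast$ be uniform in $V(G_n)$, and suppose that $(G_n,v_n^\ast)$ converges in distribution, in the local metric $d_{\mathrm{loc}}$, to a random rooted digraph $(G^\ast,r^\ast)$ with root $r^\ast$. Let $D_\ast$ be the total degree (in-degree plus out-degree) of $r^\ast$ in $G^\ast$. If $\mathbb E[D_\ast^{h-1}]<\infty$, then for every (rooted) directed tree $T$ on $h$ vertices, $$\mathbb E[\mathrm{emb}^\bullet(T,G^\ast,r^\ast)]\;\le\;2\,\mathbb E[D_\ast^{h-1}].$$ In particular, finiteness of the $(h-1)$-th total-degree moment is sufficient for finiteness of the expected number of rooted directed tree embeddings of size $h$ in the local weak limit.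
   Context: Digraphs are directed, simple and loopless: at most one arc for each ordered pair of distinct vertices (opposite arcs are allowed). A directed tree is an orientation of a finite undirected tree; here it carries an arbitrary distinguished root. $\mathcal G^\to_\ast$ is the space of rooted, connected (in the underlying undirected sense), locally finite, possibly infinite digraphs modulo rooted digraph isomorphism. The radius-$r$ ball of a rooted digraph is the induced subdigraph, rooted at the same vertex, on the vertices within undirected distance $\le r$ of the root. $d_{\mathrm{loc}}$ is the standard local metric, e.g. $d_{\mathrm{loc}}((G,v),(G',v'))=1/(1+R)$, where $R$ is the supremum of those $r\ge 0$ for which the radius-$r$ balls are isomorphic as rooted digraphs; convergence in distribution in $d_{\mathrm{loc}}$ is equivalent to convergence, for each $r$ and each finite rooted digraph $F$, of the probability that the radius-$r$ ball is isomorphic to $F$. A finite digraph with root $v$ is viewed as an element of $\mathcal G^\to_\ast$ via the connected component of $v$. $(G^\ast,r^\ast)$ is a random element of $\mathcal G^\to_\ast$. The graphs $G_n$ are deterministic and the randomness comes from $v_n^\ast$. For a rooted digraph $F$ with root $r(F)$ and a rooted digraph $(G,v)$, $\mathrm{emb}^\bullet(F,G,v)$ is the number of injective digraph homomorphisms $\varphi:V(F)\to V(G)$ (injective maps sending arcs to arcs, preserving direction) with $\varphi(r(F))=v$. *)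

(* Defs.v *)
From HB Require Import structures.
From mathcomp Require Import all_boot all_order all_algebra generic_quotient.
From mathcomp Require Import all_classical all_reals all_analysis.

Set Implicit Arguments.
Unset Strict Implicit.
Unset Printing Implicit Defensive.

Import Order.TTheory GRing.Theory Num.Theory.
Import numFieldNormedType.Exports.

Local Open Scope quotient_scope.
Local Open Scope classical_set_scope.
Local Open Scope ring_scope.

Record digraph (V : finType) := Digraph {
  darc :> rel V;
  arc_irr : irreflexive darc
}.

Definition adj {V : Type} (e : rel V) : rel V := fun x y => e x y || e y x.

Definition undirected_tree (V : finType) (e : rel V) : Prop :=
  [/\ symmetric e, irreflexive e,
      forall x y, connect e x y
    & forall c : seq V, ucycle e c -> (size c <= 2)%N].

Definition directed_tree (V : finType) (T : digraph V) : Prop :=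
  undirected_tree (adj T) /\ forall x y, ~~ (T x y && T y x).

(* A connected locally finite digraph is countable, so every class of rooted
   digraphs has a representative whose vertices are natural numbers. *)
Record rootedDigraph := RootedDigraph {
  vertex : set nat;
  arcs : rel nat;
  groot : nat
}.

Definition connected_locally_finite (G : rootedDigraph) : Prop :=
  [/\ vertex G (groot G),
      forall x y, arcs G x y -> vertex G x /\ vertex G y,
      irreflexive (arcs G),
      forall x, vertex G x ->
        exists2 p, path (adj (arcs G)) (groot G) p & last (groot G) p = x
    & forall x, finite_set [set y | adj (arcs G) x y]].

Definition rd_iso (G H : rootedDigraph) : Prop :=
  exists2 f : nat -> nat, set_bij (vertex G) (vertex H) f &
    f (groot G) = groot H /\
    {in vertex G &, forall x y, arcs H (f x) (f y) = arcs G x y}.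

Definition within_dist (G : rootedDigraph) (r : nat) (x : nat) : Prop :=
  exists p, [/\ path (adj (arcs G)) (groot G) p, last (groot G) p = x &
                (size p <= r)%N].

Definition induced (G : rootedDigraph) (A : set nat) : rootedDigraph :=
  {| vertex := A;
     arcs := fun x y => [&& x \in A, y \in A & arcs G x y];
     groot := groot G |}.

Definition root_ball (r : nat) (G : rootedDigraph) : rootedDigraph :=
  induced G (vertex G `&` within_dist G r).

(* The two numbers below are +oo when the set counted is infinite. *)
Definition total_degree (R : realType) (G : rootedDigraph) : \bar R :=
  (counting [set x | arcs G x (groot G)] + counting [set y | arcs G (groot G) y])%E.

Definition emb (R : realType) (V : finType) (F : digraph V) (rF : V)
    (G : rootedDigraph) : \bar R :=
  counting [set phi : {ffun V -> nat} |
    [/\ injective phi, forall x, vertex G (phi x),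
        forall x y, F x y -> arcs G (phi x) (phi y) & phi rF = groot G]].

(* The supremum is +oo when all balls agree, and then the distance is 0. *)
Definition loc_dist (R : realType) (G H : rootedDigraph) : R :=
  let agree : \bar R :=
    ereal_sup [set r%:R%:E | r in [set r | rd_iso (root_ball r G) (root_ball r H)]]
  in fine (1 + agree)^-1%E.

Lemma iso_refl G : rd_iso G G.
Proof.
exists id; last by split.
by split=> // x Gx; exists x.
Qed.

Lemma iso_trans G H K : vertex G (groot G) -> rd_iso G H -> rd_iso H K -> rd_iso G K.
Proof.
move=> rG [f [fun_f inj_f sur_f] [fr fa]] [g [fun_g inj_g sur_g] [gr ga]].
exists (g \o f); last first.
  split=> [|x y]; first by rewrite /= fr.
  rewrite !inE => Gx Gy /=.
  by rewrite ga ?inE; [rewrite fa ?inE|exact: fun_f|exact: fun_f].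
split=> [x Gx|x y|z Kz].
- by apply: fun_g; apply: fun_f.
- rewrite !inE => Gx Gy /= /inj_g; rewrite !inE => /(_ (fun_f _ Gx) (fun_f _ Gy)).
  by apply: inj_f; rewrite inE.
- have [y Hy <-] := sur_g _ Kz.
  by have [x Gx <-] := sur_f _ Hy; exists x.
Qed.

Lemma iso_inv G H f : vertex G (groot G) ->
    set_bij (vertex G) (vertex H) f ->
    f (groot G) = groot H ->
    {in vertex G &, forall x y, arcs H (f x) (f y) = arcs G x y} ->
  exists g, [/\ set_bij (vertex H) (vertex G) g, g (groot H) = groot G,
    {in vertex H &, forall x y, arcs G (g x) (g y) = arcs H x y} &
    {in vertex H, cancel g f}].
Proof.
move=> rG [fun_f inj_f sur_f] fr fa.
have /choice[g gP] : forall y, exists x, vertex H y -> vertex G x /\ f x = y.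
  move=> y; have [Hy|nHy] := pselect (vertex H y); last by exists 0%N.
  by have [x Gx <-] := sur_f _ Hy; exists x.
have gG y : vertex H y -> vertex G (g y) by case/gP.
have gK y : vertex H y -> f (g y) = y by case/gP.
have fH x : vertex G x -> vertex H (f x) by move=> /fun_f.
have fK x : vertex G x -> g (f x) = x.
  by move=> Gx; apply: inj_f; rewrite ?inE; [exact/gG/fH| |exact/gK/fH].
exists g; split.
- split=> [y /gG//|x y|x Gx].
  + by rewrite !inE => /gK {2}<- /gK {2}<- ->.
  + by exists (f x); [exact: fH|exact: fK].
- by rewrite -fr fK.
- move=> x y; rewrite !inE => Hx Hy.
  by rewrite -fa ?inE ?gK//; exact: gG.
- by move=> x; rewrite inE => /gK.
Qed.

Lemma iso_sym G H : vertex G (groot G) -> rd_iso G H -> rd_iso H G.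
Proof.
move=> rG [f fbij [fr fa]]; have [g [gbij gr ga _]] := iso_inv rG fbij fr fa.
by exists g.
Qed.

Lemma root_ball_root r G : vertex G (groot G) ->
  vertex (root_ball r G) (groot (root_ball r G)).
Proof. by move=> rG; split=> //; exists [::]. Qed.

Lemma root_ball_hom r s G H f : (s <= r)%N -> connected_locally_finite G ->
  set_bij (vertex (root_ball r G)) (vertex (root_ball r H)) f ->
  f (groot G) = groot H ->
  {in vertex (root_ball r G) &, forall x y,
     arcs (root_ball r H) (f x) (f y) = arcs (root_ball r G) x y} ->
  forall x, vertex (root_ball s G) x -> vertex (root_ball s H) (f x).
Proof.
move=> sr [rG aG _ _ _] [fun_f _ _] fr fa.
have wd p : path (adj (arcs G)) (groot G) p -> (size p <= r)%N ->
    vertex (root_ball r G) (last (groot G) p).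
  move=> pp pr; split; last by exists p.
  case: (lastP p) pp {pr} => // p' y; rewrite rcons_path last_rcons.
  by case/andP=> _ /orP[/aG[]|/aG[]].
have pf p : path (adj (arcs G)) (groot G) p -> (size p <= r)%N ->
    path (adj (arcs H)) (groot H) (map f p).
  elim/last_ind: p => // p y IHp ppy py; have := wd _ ppy py.
  move: (ppy); rewrite rcons_path last_rcons => /andP[pp].
  have pr : (size p <= r)%N by rewrite size_rcons in py; exact: ltnW.
  move=> xy yB; have xB := wd _ pp pr.
  rewrite map_rcons rcons_path IHp//= -fr last_map.
  have ar u v : vertex (root_ball r G) u -> vertex (root_ball r G) v ->
      arcs G u v -> arcs H (f u) (f v).
    move=> uB vB uv; have := fa u v; rewrite !inE => /(_ uB vB).
    have -> : arcs (root_ball r G) u v by rewrite /= !mem_set.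
    by case/and3P.
  by case/orP: xy => /ar a; apply/orP; [left|right]; apply: a.
move=> x [Gx [p [pp px ps]]].
have pr := leq_trans ps sr.
have xB : vertex (root_ball r G) x by split=> //; exists p.
split; first by have [] := fun_f _ xB.
exists (map f p); split; first exact: pf.
- by rewrite -fr last_map px.
- by rewrite size_map.
Qed.

Lemma root_ball_iso_le r s G H : (s <= r)%N ->
  connected_locally_finite G -> connected_locally_finite H ->
  rd_iso (root_ball r G) (root_ball r H) -> rd_iso (root_ball s G) (root_ball s H).
Proof.
move=> sr cG cH [f fbij [fr fa]].
have rG : vertex (root_ball r G) (groot (root_ball r G)).
  by apply: root_ball_root; case: cG.
have [g [gbij gr ga gK]] := iso_inv rG fbij fr fa.
have fs := root_ball_hom sr cG fbij fr fa.
have gs := root_ball_hom sr cH gbij gr ga.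
have sub K x : vertex (root_ball s K) x -> vertex (root_ball r K) x.
  by case=> Kx [p [pp px ps]]; split=> //; exists p; split=> //; exact: leq_trans sr.
exists f; last first.
  split=> // x y; rewrite !inE => xs ys.
  have := fa x y; rewrite !inE => /(_ (sub _ _ xs) (sub _ _ ys)) /=.
  rewrite !(mem_set (sub _ _ xs)) !(mem_set (sub _ _ ys)).
  rewrite !(mem_set (sub _ _ (fs _ xs))) !(mem_set (sub _ _ (fs _ ys))) /= => ->.
  by rewrite (mem_set xs) (mem_set ys) (mem_set (fs _ xs)) (mem_set (fs _ ys)).
case: fbij => _ finj _; split => // [x y|y ys].
- by rewrite !inE => /sub xr /sub yr; apply: finj; rewrite inE.
- by exists (g y); [exact: gs|apply: gK; rewrite inE; exact: sub].
Qed.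

Section loc_dist_theory.
Variable R : realType.
Implicit Types G H K : rootedDigraph.

Let agree G H : set nat := [set r | rd_iso (root_ball r G) (root_ball r H)].
Let sup_agree G H : \bar R := ereal_sup [set r%:R%:E | r in agree G H].

Let sup_agree_ge0 G H : connected_locally_finite G ->
  connected_locally_finite H -> (0 <= sup_agree G H)%E.
Proof.
move=> cG cH; apply: ereal_sup_ubound; exists 0%N => //.
have b0 K x : connected_locally_finite K ->
    vertex (root_ball 0 K) x <-> x = groot K.
  move=> [rK _ _ _ _]; split=> [|->]; last by split=> //; exists [::].
  by case=> _ [[|z p] [_ <-]].
exists (fun=> groot H); last first.
  split=> // x y; rewrite !inE => /(b0 _ _ cG) -> /(b0 _ _ cG) ->.
  by case: cG cH => _ _ iG _ _ [_ _ iH _ _] /=; rewrite iG iH !andbF.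
split=> [x _|x y|y /(b0 _ _ cH) ->].
- exact/b0.
- by rewrite !inE => /(b0 _ _ cG) -> /(b0 _ _ cG) ->.
- by exists (groot G) => //; exact/b0.
Qed.

Lemma loc_dist_refl G : loc_dist R G G = 0.
Proof.
rewrite /loc_dist -/(agree G G) -/(sup_agree G G).
suff -> : sup_agree G G = +oo%E by rewrite addey// invey.
have -> : sup_agree G G = ereal_sup (range (fun n : nat => n%:R%:E : \bar R)).
  by congr ereal_sup; congr (_ @` _); apply/seteqP;
    split=> // r _; exact: iso_refl.
apply/eqyP => M M0; have [n Mn] : exists n : nat, M <= n%:R.
  by exists (Num.truncn M).+1; exact/ltW/truncnS_gt.
apply: (@le_trans _ _ n%:R%:E); first by rewrite lee_fin.
by apply: ereal_sup_ubound; exists n.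
Qed.

Lemma loc_dist_sym G H : connected_locally_finite G ->
  connected_locally_finite H -> loc_dist R G H = loc_dist R H G.
Proof.
move=> [rG _ _ _ _] [rH _ _ _ _]; rewrite /loc_dist.
suff -> : [set r | rd_iso (root_ball r G) (root_ball r H)] =
          [set r | rd_iso (root_ball r H) (root_ball r G)] by [].
by apply/seteqP; split=> r; apply: iso_sym; exact: root_ball_root.
Qed.

Let inv0 (x : \bar R) : (0 <= x)%E -> 0 <= fine (1 + x)^-1%E.
Proof.
case: x => [x| |]//=; rewrite lee_fin => x0.
by rewrite -EFinD inver; case: eqP => //= _; rewrite invr_ge0 addr_ge0.
Qed.

Lemma loc_dist_ge0 G H : connected_locally_finite G ->
  connected_locally_finite H -> 0 <= loc_dist R G H.
Proof. by move=> cG cH; apply: inv0; exact: sup_agree_ge0. Qed.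

Let loc_dist_anti G H G' H' :
  connected_locally_finite G -> connected_locally_finite H ->
  agree G H `<=` agree G' H' -> loc_dist R G' H' <= loc_dist R G H.
Proof.
move=> cG cH sub; rewrite /loc_dist.
rewrite -/(agree G H) -/(agree G' H') -/(sup_agree G H) -/(sup_agree G' H').
have s0 := sup_agree_ge0 cG cH.
have le : (sup_agree G H <= sup_agree G' H')%E.
  by apply: ereal_sup_le => _ [r /sub Hr <-]; exists r.
case: (sup_agree G' H') le => [y| |] le; first last.
- by move: (le_trans s0 le).
- by rewrite addey// invey/= inv0.
case: (sup_agree G H) s0 le => [x| |] //=.
rewrite !lee_fin => x0 xy; have y0 := le_trans x0 xy.
have p0 (z : R) : 0 <= z -> 0 < 1 + z by move=> z0; rewrite ltr_pwDl.
rewrite -!EFinD !inver !gt_eqF ?p0//= lef_pV2 ?posrE ?p0//.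
by rewrite lerD2l.
Qed.

Lemma loc_dist_ultra G H K : connected_locally_finite G ->
  connected_locally_finite H -> connected_locally_finite K ->
  loc_dist R G K <= Num.max (loc_dist R G H) (loc_dist R H K).
Proof.
move=> cG cH cK; rewrite le_max.
have tr r : agree G H r -> agree H K r -> agree G K r.
  by apply: iso_trans; apply: root_ball_root; case: cG.
have [sub|/existsNP[r /not_implyP[rGH rHK]]] :=
  pselect (agree G H `<=` agree H K).
  by apply/orP; left; apply: loc_dist_anti => // r rGH; exact: tr (sub _ rGH).
apply/orP; right; apply: loc_dist_anti => // s sHK; apply: tr => //.
apply: root_ball_iso_le rGH => //; rewrite leqNgt; apply/negP => rs.
by apply: rHK; apply: root_ball_iso_le sHK => //; exact: ltnW.
Qed.


End loc_dist_theory.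

Record clDigraph := ClDigraph {
  clgraph :> rootedDigraph;
  clgraphP : connected_locally_finite clgraph
}.

HB.instance Definition _ := gen_eqMixin clDigraph.
HB.instance Definition _ := gen_choiceMixin clDigraph.

Definition cliso : rel clDigraph := fun G H => `[< rd_iso G H >].

Lemma cliso_refl : reflexive cliso.
Proof. by move=> G; apply/asboolP; exact: iso_refl. Qed.

Lemma cliso_sym : symmetric cliso.
Proof.
move=> G H; apply/asboolP/asboolP; apply: iso_sym.
  by case: (clgraphP G).
by case: (clgraphP H).
Qed.

Lemma cliso_trans : transitive cliso.
Proof.
move=> H G K /asboolP GH /asboolP HK; apply/asboolP; apply: iso_trans GH HK.
by case: (clgraphP G).
Qed.

Canonical cliso_equiv := EquivRel cliso cliso_refl cliso_sym cliso_trans.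

(* The real type only serves to attach the real-valued metric. *)
Definition Gstar (R : realType) : Type := {eq_quot cliso}.

HB.instance Definition _ (R : realType) := Choice.on (Gstar R).

Definition graph_class (R : realType) (G : clDigraph) : Gstar R :=
  (\pi_({eq_quot cliso}) G)%qT.

(* total_degree and emb are invariant under rd_iso, so that they may be evaluated
   at this representative. *)
Definition class_repr (R : realType) (x : Gstar R) : rootedDigraph :=
  (repr (x : {eq_quot cliso}) : clDigraph).

Definition single_vertex : rootedDigraph :=
  {| vertex := [set 0%N]; arcs := fun _ _ => false; groot := 0%N |}.

Lemma single_vertexP : connected_locally_finite single_vertex.
Proof.
split=> //= [x -> /=|x]; first by exists [::].
by rewrite /adj/= (_ : [set _ | _] = set0)//; apply/seteqP; split.
Qed.

HB.instance Definition _ (R : realType) :=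
  isPointed.Build (Gstar R) (graph_class R (ClDigraph single_vertexP)).

Section Gstar_topology.
Variable R : realType.
Implicit Types x y z : Gstar R.

Definition gdist x y : R := loc_dist R (class_repr x) (class_repr y).

Lemma class_reprP x : connected_locally_finite (class_repr x).
Proof. exact: clgraphP. Qed.

Let gball x (e : R) : set (Gstar R) := [set y | gdist x y < e].

Let gball_center x (e : R) : 0 < e -> gball x e x.
Proof. by rewrite /gball/= /gdist loc_dist_refl. Qed.

Let gball_sym x y (e : R) : gball x e y -> gball y e x.
Proof. by rewrite /gball/= /gdist loc_dist_sym//; exact: class_reprP. Qed.

Let gball_triangle x y z (e1 e2 : R) :
  gball x e1 y -> gball y e2 z -> gball x (e1 + e2) z.
Proof.
have ge0 u v : 0 <= gdist u v by exact: loc_dist_ge0 (class_reprP _) (class_reprP _).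
rewrite /gball/= => xy yz.
have := @loc_dist_ultra R _ _ _ (class_reprP x) (class_reprP y) (class_reprP z).
rewrite -/(gdist x y) -/(gdist y z) -/(gdist x z) => /le_lt_trans; apply.
rewrite gt_max; apply/andP; split.
  by apply: (lt_le_trans xy); rewrite lerDl (le_trans _ (ltW yz)).
by apply: (lt_le_trans yz); rewrite lerDr (le_trans _ (ltW xy)).
Qed.

HB.instance Definition _ :=
  hasNbhs.Build (Gstar R) (nbhs_ (entourage_ gball)).

HB.instance Definition _ := @Nbhs_isPseudoMetric.Build R (Gstar R)
  (entourage_ gball) erefl gball gball_center gball_sym gball_triangle erefl.

End Gstar_topology.

Lemma Gstar_ballE (R : realType) (x : Gstar R) (e : R) :
  ball x e = [set y | gdist x y < e].
Proof. by []. Qed.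

HB.instance Definition _ (R : realType) :=
  @isMeasurable.Build (sigma_display (@open (Gstar R))) (Gstar R)
    <<s @open (Gstar R) >> (@sigma_algebra0 _ setT _) (@sigma_algebraC _ _)
    (@sigma_algebra_bigcup _ setT _).

Section component.
Variables (V : finType) (G : digraph V) (v : V).

Let code (u : V) : nat := enum_rank u.

Let code_inj : injective code.
Proof. by move=> x y /ord_inj /enum_rank_inj. Qed.

(* A vertex u of the component of v is renamed enum_rank u. *)
Definition component : rootedDigraph :=
  {| vertex := [set (enum_rank u : nat) | u in [set u | connect (adj G) v u]];
     arcs := fun x y => [exists u, exists w,
       [&& connect (adj G) v u, G u w,
           x == enum_rank u :> nat & y == enum_rank w :> nat]];
     groot := enum_rank v |}.

Let componentE u w : connect (adj G) v u ->
  arcs component (code u) (code w) = G u w.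
Proof.
move=> vu; apply/existsP/idP => [[a /existsP[b /and4P[_ ab /eqP ea /eqP eb]]]|uw].
  by rewrite (code_inj ea) (code_inj eb).
by exists u; apply/existsP; exists w; rewrite vu uw !eqxx.
Qed.

Let componentP x y : arcs component x y -> exists u w,
  [/\ connect (adj G) v u, connect (adj G) v w, G u w, x = code u & y = code w].
Proof.
case/existsP=> u /existsP[w /and4P[vu uw /eqP-> /eqP->]].
exists u, w; split=> //; apply: connect_trans vu _.
by apply: connect1; rewrite /adj uw.
Qed.

Lemma component_clf : connected_locally_finite component.
Proof.
split.
- by exists v => //=.
- move=> x y /componentP[u [w [vu vw _ -> ->]]].
  by split; [exists u|exists w].
- move=> x; apply/negbTE/negP => /componentP[u [w [_ _ uw -> /code_inj uw']]].
  by rewrite -uw' arc_irr in uw.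
- move=> _ [u /connectP[p pp ->] <-].
  exists (map code p); last by rewrite /= -/(code v) last_map.
  suff path_code x : connect (adj G) v x -> path (adj G) x p ->
      path (adj (arcs component)) (code x) (map code p).
    exact: path_code (connect0 _ _) pp.
  elim: p x {pp} => // y p IHp x vx /andP[xy yp].
  have vy : connect (adj G) v y by apply: connect_trans vx (connect1 xy).
  have xy' : adj (arcs component) (code x) (code y) by rewrite /adj !componentE.
  by apply/andP; split=> //; exact: IHp.
- move=> x; apply: (@sub_finite_set _ _ (range code)).
    by move=> y /= /orP[] /componentP[u [w [_ _ _ e e']]];
      [exists w|exists u].
  exact: finite_image.
Qed.

Definition component_class (R : realType) : Gstar R :=
  graph_class R (ClDigraph component_clf).

End component.

(* Weak convergence of the laws: as v_n is uniform on V(G_n), the expectation of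
   f (G_n, v_n) is the average of f over the vertices of G_n. *)
Definition cvg_local (R : realType) (V : nat -> finType)
    (G : forall n, digraph (V n)) (d : measure_display) (Omega : measurableType d)
    (P : probability Omega R) (X : {RV P >-> Gstar R}) : Prop :=
  forall f : Gstar R -> R, continuous f -> (exists M, forall x, `|f x| <= M) ->
    (\sum_(v : V n) f (component_class (G n) v R)) / #|V n|%:R @[n --> \oo]
      --> (\int[P]_w f (X w))%R.

(* Main.v *)
Require Import Defs.
From mathcomp Require Import all_boot all_order all_algebra finmap generic_quotient.
From mathcomp Require Import all_classical all_reals all_analysis.
From mathcomp Require Import zify measurable_realfun.

Set Implicit Arguments.
Unset Strict Implicit.
Unset Printing Implicit Defensive.

Import Order.TTheory GRing.Theory Num.Theory.
Import numFieldNormedType.Exports.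

(** The bound is a property of finite graphs that passes to local limits.

    Finite graphs.  For a relation [H] on a finite set and a connected graph on
    [h] vertices, the number of homomorphisms from the latter to [H] is at most
    the sum over [v] of [d(v) ^ (h - 1)], where [d(v)] is the number of
    [H]-neighbours of [v] ([hom_count]).  The induction proves more: for a vertex
    [i] of the connected graph, the sum over all homomorphisms [phi] of
    [d(phi i) ^ A] is at most the sum over [v] of [d(v) ^ (h - 1 + A)]
    ([partial_hom_weight]).  Pick a vertex [l <> i] whose removal leaves the graph
    connected, with a neighbour [p] ([linked_peel]).  Summing over the image of
    [l] costs at most a factor [d(phi p)], and Young's inequality
    [(A + 1) x^A y <= A x^(A+1) + y^(A+1)] moves the product
    [d(phi i)^A d(phi p)] onto a single vertex again, with exponent [A + 1].

    Limit.  Local convergence only tests bounded continuous functions, and the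
    [(h-1)]-th degree moments of the [G_n] need not converge.  So keep only the
    embeddings all of whose vertices have at most [K] neighbours in the graph:
    they are embeddings into the subgraph induced by the vertices with at most
    [K] neighbours, and the finite bound for that subgraph involves only the
    roots with at most [K] neighbours ([sum_tame_emb_component]).  Both sides,
    the left one capped at [K], now depend on a ball of bounded radius around the
    root, so they are locally constant, hence continuous and measurable, on the
    space of rooted digraphs ([local_stat_open]), and they are bounded.  The
    inequality therefore survives in the limit ([local_limit_le]).  The right
    side is at most the moment of the total degree.  As [K] grows, the left side
    increases to the number of all embeddings and is eventually equal to it,
    because the graph is locally finite ([tame_emb_eventually]); monotone
    convergence concludes. *)

(** * Homomorphisms from a finite connected graph *)

Section homomorphism_count.
(* In this section [set0], [set _ | _] and the set operations are those of the
   decidable finite sets [{set _}]. *)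
Import boot.fintype boot.finset.
Local Open Scope nat_scope.

(** Young's inequality with the denominators cleared. *)
Lemma young_nat (A x y : nat) :
  A.+1 * (x ^ A * y) <= A * x ^ A.+1 + y ^ A.+1.
Proof.
elim: A => [|A IH]; first by rewrite !expn0 mul1n mul1n mul0n expn1.
have rearr : x * y ^ A.+1 + x ^ A.+1 * y <= x ^ A.+2 + y ^ A.+2.
  rewrite ![_ ^ A.+2]expnS.
  have [xy|/ltnW yx] := leqP x y.
    by have : x ^ A.+1 <= y ^ A.+1 by [rewrite leq_exp2r]; nia.
  by have : y ^ A.+1 <= x ^ A.+1 by [rewrite leq_exp2r]; nia.
have := leq_mul (leqnn x) IH; move: rearr; rewrite ![x ^ A.+2]expnS ![x ^ A.+1]expnS.
set a := x ^ A; set b := y ^ A.+1; set c := y ^ A.+2; nia.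
Qed.

Lemma leq_sum_inj (I J : finType) (A : {pred I}) (B : {pred J}) (h : I -> J)
    (F : J -> nat) :
  {in A &, injective h} -> {in A, forall i, h i \in B} ->
  \sum_(i in A) F (h i) <= \sum_(j in B) F j.
Proof.
move=> hinj hB; rewrite -(big_imset _ hinj)/=.
rewrite [leqRHS](bigID (mem (imset h (mem A))))/=.
apply: (leq_trans _ (leq_addr _ _)).
rewrite [leqRHS](eq_bigl (mem (imset h (mem A))))// => j.
rewrite /= andbC; case: imsetP => //= -[i iA ->]; exact: hB.
Qed.

Section linked.
Variables (I : finType) (e : rel I).
Hypothesis e_sym : symmetric e.
Local Open Scope set_scope.
Implicit Types S A : {set I}.

(** Connectedness of the induced subgraph, in the form of cuts: this form passes
    from [S] to [l |: S] without handling paths. *)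
Definition linked S := [forall A : {set I},
  [&& A \subset S, A != set0 & A != S] ==>
  [exists x in A, exists y in S :\: A, e x y]].

Lemma linkedP S : reflect
  (forall A, A \subset S -> A != set0 -> A != S ->
     exists x y, [/\ x \in A, y \in S :\: A & e x y])
  (linked S).
Proof.
apply: (iffP forallP) => [H A AS A0 AnS|H A].
  have /implyP := H A; rewrite AS A0 AnS => /(_ isT)/exists_inP[x xA].
  by case/exists_inP=> y yS xy; exists x, y.
apply/implyP => /and3P[AS A0 AnS]; have [x [y [xA yS xy]]] := H A AS A0 AnS.
by apply/exists_inP; exists x => //; apply/exists_inP; exists y.
Qed.

Lemma linked_setT : (forall x y, connect e x y) -> linked setT.
Proof.
move=> conn; apply/linkedP => A _ /set0Pn[a aA] AT.
have [/exists_inP[x xA /exists_inP[y yA xy]]|H] :=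
  boolP [exists x in A, exists y in [set: I] :\: A, e x y].
  by exists x, y.
have cl x y : e x y -> x \in A -> y \in A.
  move=> xy xA; apply: contraNT H => yA.
  apply/exists_inP; exists x => //; apply/exists_inP; exists y => //.
  by rewrite !inE andbT.
case/negP: AT; rewrite eqEsubset subsetT/=; apply/subsetP => y _.
rewrite -(@closed_connect _ e (mem A) _ a y)// => u v uv.
by apply/idP/idP; apply: cl; rewrite // e_sym.
Qed.

Lemma linked_set1 i : linked [set i].
Proof.
apply/linkedP => A; rewrite subset1 => /orP[/eqP->|/eqP->].
  by rewrite eqxx.
by rewrite eqxx.
Qed.

Lemma linkedU1 S p l : linked S -> p \in S -> l \notin S -> e p l ->
  linked (l |: S).
Proof.
move=> /linkedP lS pS lnS pl; apply/linkedP => A AS A0 AnS.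
have [B0|B0] := eqVneq (A :&: S) set0.
  have pA : p \notin A.
    by apply/negP => pA; have := in_set0 p; rewrite -B0 inE pA pS.
  have [a aA] := set0Pn _ A0; exists a, p; split=> //.
    by rewrite !inE pA pS orbT.
  have /setU1P[->|aS] := subsetP AS _ aA; first by rewrite e_sym.
  by have := in_set0 a; rewrite -B0 inE aA aS.
have [BS|BS] := eqVneq (A :&: S) S.
  have SA : S \subset A by rewrite -BS subsetIl.
  exists p, l; split=> //; first exact: (subsetP SA).
  rewrite !inE eqxx andbT; apply: contra AnS => lA.
  by rewrite eqEsubset AS subUset sub1set lA.
have [x [y [xB yB xy]]] := lS _ (subsetIr A S) B0 BS.
move: xB yB; rewrite !inE => /andP[xA xS] /andP[+ yS].
rewrite yS andbT => yA; exists x, y; split=> //.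
by rewrite !inE yA yS orbT.
Qed.

(** The maximal proper connected subset of [S] containing [i] misses exactly one
    vertex [l]: some edge leaves it inside [S], and adding the far end of that edge
    keeps it connected, so by maximality gives all of [S].  Asking that the subset
    contain [i] is what makes [l] different from [i]. *)
Lemma linked_peel S i : linked S -> i \in S -> S != [set i] ->
  exists l p S', [/\ S = l |: S', l \notin S', linked S', i \in S' & p \in S'] /\ e p l.
Proof.
move=> lS iS Si; pose P (B : {set I}) := [&& i \in B, linked B & B \proper S].
have P0 : P [set i].
  by rewrite /P inE eqxx linked_set1 properEneq eq_sym Si sub1set iS.
have [B /maxsetP[/and3P[iB lB BS] Bmax] _] := maxset_exists P0.
have [p [l [pB lSB pl]]] := linkedP _ lS B (proper_sub BS)
  (introT (set0Pn B) (ex_intro _ i iB)) (proper_neq BS).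
move: lSB; rewrite inE => /andP[lB' lS'].
exists l, p, B; split=> //; split=> //.
apply/eqP/negPn/negP => neq.
have PB : P (l |: B).
  rewrite /P !inE iB orbT (linkedU1 lB pB)//= properEneq eq_sym neq.
  by rewrite subUset sub1set lS' proper_sub.
have := Bmax _ PB (subsetUr _ _) => /setP/(_ l).
by rewrite !inE eqxx (negbTE lB').
Qed.

End linked.

Section hom_count.
Variables (I V : finType) (e : rel I) (H : rel V) (v0 : V).
Hypothesis e_sym : symmetric e.
Local Open Scope set_scope.

(** Homomorphisms defined on [S]; the constant [v0] outside [S] ensures that each
    of them is counted once. *)
Definition partial_hom (S : {set I}) : {set {ffun I -> V}} :=
  [set phi : {ffun I -> V} |
    [forall x in S, forall y in S, e x y ==> H (phi x) (phi y)] &&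
    [forall x in ~: S, phi x == v0]].

Lemma partial_homP (S : {set I}) (phi : {ffun I -> V}) : reflect
  [/\ {in S &, forall x y, e x y -> H (phi x) (phi y)} &
      {in ~: S, forall x, phi x = v0}]
  (phi \in partial_hom S).
Proof.
rewrite inE; apply: (iffP andP) => -[h1 h2]; split.
- move=> x y xS yS xy; have /forall_inP/(_ x xS)/forall_inP/(_ y yS) := h1.
  by rewrite xy.
- by move=> x xS; have /forall_inP/(_ x xS)/eqP := h2.
- apply/forall_inP => x xS; apply/forall_inP => y yS; apply/implyP.
  exact: h1.
- by apply/forall_inP => x xS; apply/eqP/h2.
Qed.

(** The weight sits on one vertex [i] only, so that some other vertex can always
    be peeled off; Young's inequality restores this form after each removal. *)
Lemma partial_hom_weight (S : {set I}) (i : I) (A : nat) :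
  linked e S -> i \in S ->
  \sum_(phi in partial_hom S) #|H (phi i)| ^ A
    <= \sum_v #|H v| ^ (#|S|.-1 + A).
Proof.
move=> + iS; have [n] := ubnP #|S|; elim: n => // n IH in S i A iS *.
rewrite ltnS => Sn lS; have [Si|Si] := eqVneq S [set i].
  rewrite Si cards1 add0n.
  have := @leq_sum_inj _ _ (mem (partial_hom [set i])) predT
    (fun phi : {ffun I -> V} => phi i) (fun v => #|H v| ^ A).
  apply=> // phi psi /partial_homP[_ h1] /partial_homP[_ h2] eqi.
  apply/ffunP => x; have [->//|xi] := eqVneq x i.
  by rewrite h1 ?h2 ?inE.
have [l [p [S' [[SE lS' lkS' iS' pS'] pl]]]] := linked_peel e_sym lS iS Si.
have cS : #|S| = #|S'|.+1 by rewrite SE cardsU1 lS'.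
have S'n : #|S'| < n by rewrite -cS.
have [m mS'] : exists m, #|S'| = m.+1.
  by exists #|S'|.-1; rewrite prednK//; apply/card_gt0P; exists i.
pose upd (phi : {ffun I -> V}) : {ffun I -> V} :=
  [ffun x => if x == l then v0 else phi x].
have updE phi x : x \in S' -> upd phi x = phi x.
  by move=> xS'; rewrite ffunE; case: eqP => // xl; rewrite -xl xS' in lS'.
pose D : {pred {ffun I -> V} * V} :=
  [pred u | (u.1 \in partial_hom S') && (u.2 \in H (u.1 p))].
(* A homomorphism on [S] is its restriction to [S'] together with the image of
   [l], which is a neighbour of the image of [p]. *)
have step : \sum_(phi in partial_hom S) #|H (phi i)| ^ A <=
    \sum_(phi in partial_hom S') #|H (phi i)| ^ A * #|H (phi p)|.
  under eq_bigr do rewrite -(updE _ _ iS').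
  have := @leq_sum_inj _ _ (mem (partial_hom S)) D
    (fun phi => (upd phi, phi l)) (fun u => #|H (u.1 i)| ^ A).
  move=> /(_ _ _)/leq_trans; apply; rewrite /=.
  - move=> phi psi phiS psiS [/ffunP eupd el]; apply/ffunP => x.
    by have := eupd x; rewrite !ffunE; case: eqP => // ->.
  - move=> phi /partial_homP[hom out]; rewrite unfold_in/=; apply/andP; split.
      apply/partial_homP; split=> [x y xS' yS' xy|x].
        by rewrite !updE//; apply: hom => //; rewrite SE !inE ?xS' ?yS' orbT.
      rewrite inE => xS'; rewrite ffunE; case: eqP => // /eqP xl.
      by apply: out; rewrite SE !inE negb_or xl.
    rewrite updE// unfold_in; apply: hom => //; rewrite SE !inE ?eqxx//.
    by rewrite pS' orbT.
  - under [leqRHS]eq_bigr do rewrite mulnC -sum_nat_const.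
    rewrite pair_big_dep/=; apply: eq_leq; apply: eq_bigl => u.
    by rewrite !inE.
rewrite -(leq_pmul2l (ltn0Sn A)).
apply: (leq_trans (leq_mul (leqnn _) step)); rewrite big_distrr/=.
have yng : \sum_(phi in partial_hom S') A.+1 * (#|H (phi i)| ^ A * #|H (phi p)|)
  <= \sum_(phi in partial_hom S')
      (A * #|H (phi i)| ^ A.+1 + #|H (phi p)| ^ A.+1).
  by apply: leq_sum => phi _; exact: young_nat.
apply: (leq_trans yng); rewrite big_split -big_distrr/=.
rewrite cS mS'/= addSnnS mulSn [leqRHS]addnC.
rewrite (_ : m = #|S'|.-1); last by rewrite mS'.
by rewrite leq_add ?leq_mul//; apply: IH.
Qed.

End hom_count.

(** For symmetric [H] the right side is the number of homomorphisms from a star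
    on [#|I|] vertices, so that stars are extremal among connected graphs. *)
Lemma hom_count (I V : finType) (e : rel I) (H : rel V) :
  symmetric e -> (forall x y, connect e x y) -> (0 < #|I|)%N ->
  #|[set phi : {ffun I -> V} | [forall x, forall y, e x y ==> H (phi x) (phi y)]]%SET|
    <= \sum_v #|H v| ^ (#|I|.-1).
Proof.
move=> e_sym conn /card_gt0P[i _].
have [V0|/card_gt0P[v0 _]] := posnP #|V|.
  rewrite (_ : #|_| = 0)//; apply: eq_card0 => phi.
  by case: (fintype0 (phi i) V0).
have := @partial_hom_weight I V e H v0 e_sym setT i 0 (linked_setT e_sym conn) (in_setT i).
rewrite cardsT addn0; apply: leq_trans.
rewrite sum1dep_card; apply: subset_leq_card; apply/subsetP => phi.
rewrite in_set => /forallP h; rewrite in_set; apply/partial_homP; split=> x.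
  by move=> y _ _; have /forallP/(_ y)/implyP := h x.
by rewrite !inE.
Qed.

End homomorphism_count.

Local Open Scope classical_set_scope.
Local Open Scope card_scope.
Local Open Scope ring_scope.
Local Open Scope ereal_scope.

(** * Counting and bijections *)

Section counting_card.
Variable R : realType.

Lemma counting_le (T U : choiceType) (A : set T) (B : set U) :
  A #<= B -> counting A <= counting B :> \bar R.
Proof.
move=> AB; rewrite /counting; case: (asboolP (finite_set B)) => [finB|_]; last exact: leey.
have finA := card_le_finite AB finB; rewrite asboolT// lee_fin ler_nat.
have [n Bn] := finB; rewrite (card_fset_set Bn).
by apply: geq_card_fset_set; rewrite -(card_le_eqr Bn).
Qed.

Lemma counting_eq (T U : choiceType) (A : set T) (B : set U) :
  A #= B -> counting A = counting B :> \bar R.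
Proof.
by case/card_eqPle => AB BA; apply/eqP; rewrite eq_le !counting_le.
Qed.

Lemma counting_ge0 (T : choiceType) (A : set T) : 0 <= counting A :> \bar R.
Proof.
by rewrite /counting; case: ifP => // _; rewrite lee_fin.
Qed.

Lemma counting_II (T : choiceType) (A : set T) n :
  A #= `I_n -> counting A = n%:R%:E :> \bar R.
Proof.
by move=> An; rewrite /counting asboolT ?(card_fset_set An)//; exists n.
Qed.

End counting_card.

Lemma card_fin_pred (T : finType) (A : {pred T}) : [set` A] #= `I_#|A|.
Proof.
have -> : [set` A] = [set` [fset x in A]%fset].
  by apply/seteqP; split=> x /=; rewrite inE.
by apply/card_eq_fsetP; rewrite card_finset.
Qed.

(** * Invariance under isomorphism *)

Definition neighbors (G : rootedDigraph) (x : nat) : set nat :=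
  [set y | adj (arcs G) x y].

(** The part of [connected_locally_finite] that balls inherit as it stands. *)
Definition arcs_within (G : rootedDigraph) : Prop :=
  forall x y, arcs G x y -> vertex G x /\ vertex G y.

Lemma card_bij_restrict (A B P Q : set nat) (f : nat -> nat) :
  set_bij A B f -> P `<=` A -> Q `<=` B -> (forall y, A y -> Q (f y) <-> P y) ->
  Q #= P.
Proof.
move=> [fun_f inj_f sur_f] PA QB PQ.
have -> : Q = f @` P.
  apply/seteqP; split=> [z Qz|_ [y Py <-]]; last exact/PQ/Py/PA.
  by have [y Ay yz] := sur_f _ (QB _ Qz); exists y => //; apply/PQ; rewrite ?yz.
apply: inj_card_eq => x y; rewrite !inE => /PA xA /PA yA.
by apply: inj_f; rewrite inE.
Qed.

Section iso_neighbors.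
Variables (G H : rootedDigraph) (f : nat -> nat).
Hypotheses (aG : arcs_within G) (aH : arcs_within H).
Hypotheses (fbij : set_bij (vertex G) (vertex H) f).
Hypothesis fa : {in vertex G &, forall x y, arcs H (f x) (f y) = arcs G x y}.

Lemma iso_arcs x y : vertex G x -> vertex G y -> arcs H (f x) (f y) = arcs G x y.
Proof. by move=> Gx Gy; apply: fa; rewrite inE. Qed.

Lemma iso_out x : vertex G x -> [set y | arcs H (f x) y] #= [set y | arcs G x y].
Proof.
move=> Gx; apply: (card_bij_restrict fbij) => [y /aG[]|y /aH[]|y Gy]//=.
by rewrite iso_arcs.
Qed.

Lemma iso_in x : vertex G x -> [set y | arcs H y (f x)] #= [set y | arcs G y x].
Proof.
move=> Gx; apply: (card_bij_restrict fbij) => [y /aG[]|y /aH[]|y Gy]//=.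
by rewrite iso_arcs.
Qed.

Lemma iso_neighbors x : vertex G x -> neighbors H (f x) #= neighbors G x.
Proof.
move=> Gx; apply: (card_bij_restrict fbij) => [y /orP[]/aG[]|y /orP[]/aH[]|y Gy]//=.
by rewrite /neighbors/= /adj !iso_arcs.
Qed.

End iso_neighbors.

Section local_statistics.
Variables (I : finType) (F : digraph I) (r : I).

Definition emb_set (G : rootedDigraph) : set {ffun I -> nat} :=
  [set phi : {ffun I -> nat} |
    [/\ injective phi, forall x, vertex G (phi x),
        forall x y, F x y -> arcs G (phi x) (phi y) & phi r = groot G]].

(** The truncation is by the number of undirected neighbours, which is the degree
    that governs the homomorphism bound. *)
Definition tame_emb (K : nat) (G : rootedDigraph) : set {ffun I -> nat} :=
  [set phi | emb_set G phi /\ forall x, neighbors G (phi x) #<= `I_K].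

Lemma tame_emb_iso_le K G H : arcs_within G -> arcs_within H ->
  rd_iso G H -> tame_emb K G #<= tame_emb K H.
Proof.
move=> aG aH [f fbij [fr fa]].
pose h (phi : {ffun I -> nat}) : {ffun I -> nat} := [ffun x => f (phi x)].
have [fun_f inj_f _] := fbij.
have hinj : {in tame_emb K G &, injective h}.
  move=> phi psi; rewrite !inE => -[[_ vphi _ _] _] [[_ vpsi _ _] _] /ffunP eqh.
  apply/ffunP => x; have := eqh x; rewrite !ffunE; apply: inj_f; rewrite inE//.
rewrite -(card_le_eql (inj_card_eq hinj)); apply: subset_card_le.
move=> _ [phi [[phi_inj vphi aphi phir] dphi] <-]; split.
  split=> [x y|x|x y xy|]; rewrite !ffunE.
  - by move=> /inj_f eqf; apply: phi_inj; apply: eqf; rewrite inE.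
  - exact: fun_f.
  - by rewrite (iso_arcs fa)//; exact: aphi.
  - by rewrite phir.
move=> x; rewrite ffunE (card_le_eql (iso_neighbors aG aH fbij fa (vphi x))).
exact: dphi.
Qed.

Lemma tame_emb_iso K G H : vertex G (groot G) -> arcs_within G -> arcs_within H ->
  rd_iso G H -> tame_emb K G #= tame_emb K H.
Proof.
move=> rG aG aH GH; apply/card_eqPle; split; apply: tame_emb_iso_le => //.
exact: iso_sym GH.
Qed.

End local_statistics.

(** * Dependence on a ball around the root *)

Section balls.
Variables (G : rootedDigraph).
Hypothesis clfG : connected_locally_finite G.

Lemma clf_arcs_within : arcs_within G. Proof. by case: clfG. Qed.
Lemma clf_root : vertex G (groot G). Proof. by case: clfG. Qed.

Lemma ball_arcs_within n : arcs_within (root_ball n G).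
Proof. by move=> x y /and3P[/set_mem ? /set_mem]. Qed.

Lemma within_dist_adj k x y :
  within_dist G k x -> adj (arcs G) x y -> within_dist G k.+1 y.
Proof.
move=> [p [pp px pk]] xy; exists (rcons p y).
by rewrite rcons_path pp px last_rcons size_rcons.
Qed.

(** The bound is strict because the neighbours of [x] must lie in the ball too. *)
Lemma ball_arcs n k x y : within_dist G k x -> (k < n)%N ->
  (arcs (root_ball n G) x y = arcs G x y) * (arcs (root_ball n G) y x = arcs G y x).
Proof.
move=> xk kn.
have inball z w : within_dist G k z -> adj (arcs G) z w -> w \in vertex G `&` within_dist G n.
  move=> zk zw; rewrite inE; split.
    by case/orP: zw => /clf_arcs_within[].
  by have [p [? ? ps]] := within_dist_adj zk zw; exists p; split=> //; exact: leq_trans kn.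
have inx z : adj (arcs G) x z -> x \in vertex G `&` within_dist G n.
  move=> xz; rewrite inE; split.
    by case/orP: xz => /clf_arcs_within[].
  have [p [? ? ps]] := xk; exists p; split=> //.
  exact: leq_trans (ltnW kn).
split; apply/and3P/idP => [[]//|a]; split=> //.
- by apply: (inx y); rewrite /adj a.
- by apply: (inball x) => //; rewrite /adj a.
- by apply: (inball x) => //; rewrite /adj a orbT.
- by apply: (inx y); rewrite /adj a orbT.
Qed.

Lemma ball_neighbors n k x : within_dist G k x -> (k < n)%N ->
  neighbors (root_ball n G) x = neighbors G x.
Proof.
by move=> xk kn; apply/seteqP; split=> y; rewrite /neighbors/mkset /adj !(ball_arcs _ xk kn)//.
Qed.

Variables (I : finType) (F : digraph I) (r : I).
Hypothesis conn : forall x y, connect (adj F) x y.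

(** A simple path of the pattern from [r] to [x] has fewer than [#|I|] arcs, and
    its image is a path from the root. *)
Lemma hom_within_dist (phi : I -> nat) :
  (forall x y, F x y -> arcs G (phi x) (phi y)) -> phi r = groot G ->
  forall x, within_dist G #|I|.-1 (phi x).
Proof.
move=> hom phir x; have /connectP[p0 pp0 ->] := conn r x.
case/shortenP: pp0 => p pp up _.
exists (map phi p); rewrite -phir last_map size_map; split=> //.
  rewrite path_map; apply: sub_path pp => y z /orP[]/hom yz; rewrite /= /adj yz//.
  by rewrite orbT.
have /(leq_trans _) : (#|r :: p| <= #|I|)%N by exact: max_card.
by move/card_uniqP: up => -> /(_ (size p).+1 (leqnn _)); case: #|I|.
Qed.

Lemma tame_emb_ball K : tame_emb F r K (root_ball #|I| G) = tame_emb F r K G.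
Proof.
have I0 : (#|I|.-1 < #|I|)%N by rewrite prednK//; apply/card_gt0P; exists r.
apply/seteqP; split=> phi [[phi_inj vphi aphi phir] dphi].
  have aphi' x y : F x y -> arcs G (phi x) (phi y) by move=> /aphi/and3P[].
  have wd := hom_within_dist aphi' phir.
  split; first by split=> // x; case: (vphi x).
  by move=> x; rewrite -(ball_neighbors (wd x) I0).
have wd := hom_within_dist aphi phir.
split; last by move=> x; rewrite (ball_neighbors (wd x) I0).
split=> // [x|x y xy]; last by rewrite (ball_arcs _ (wd x) I0); exact: aphi.
split=> //; have [p [? ? ps]] := wd x; exists p; split=> //.
exact: leq_trans (ltnW I0).
Qed.

End balls.

(** * Local statistics on the space of rooted digraphs *)

(** Invariance is asked of all rooted digraphs whose arcs join vertices, so that it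
    applies to balls, whose connectedness and local finiteness are not at hand, as
    well as to components and to class representatives. *)
Definition local_stat (T : Type) (n : nat) (S : rootedDigraph -> T) : Prop :=
  (forall G H, vertex G (groot G) -> arcs_within G -> arcs_within H ->
     rd_iso G H -> S G = S H) /\
  (forall G, connected_locally_finite G -> S (root_ball n G) = S G).

Section local_stat_theory.
Variables (R : realType).

Lemma local_stat_comp (T U : Type) n (S : rootedDigraph -> T) (f : T -> U) :
  local_stat n S -> local_stat n (f \o S).
Proof.
by case=> Siso Sball; split=> [G H *|G cG] /=; [rewrite (Siso G H)|rewrite Sball].
Qed.

Lemma local_stat_agree (T : Type) n (S : rootedDigraph -> T) G H :
  local_stat n S -> connected_locally_finite G -> connected_locally_finite H ->
  rd_iso (root_ball n G) (root_ball n H) -> S G = S H.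
Proof.
move=> [Siso Sball] cG cH GH; rewrite -(Sball _ cG) -(Sball _ cH).
apply: Siso GH; [exact/root_ball_root/clf_root|exact: ball_arcs_within..].
Qed.

(** If the balls of radius [n] differ, so do all larger ones; hence the supremum
    defining the distance is at most [n]. *)
Lemma gdist_agree n (x y : Gstar R) :
  (gdist x y < (1 + n%:R)^-1)%R ->
  rd_iso (root_ball n (class_repr x)) (root_ball n (class_repr y)).
Proof.
have cx := class_reprP x; have cy := class_reprP y.
apply: contraPP => niso; apply/negP; rewrite -leNgt /gdist /loc_dist.
set A := [set r | _]; set s := ereal_sup _.
have s_le : s <= n%:R%:E.
  apply: ge_ereal_sup => _ [r Ar <-]; rewrite lee_fin ler_nat leqNgt.
  by apply/negP => /ltnW nr; apply: niso; exact: root_ball_iso_le Ar.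
have b0 K z : connected_locally_finite K ->
    vertex (root_ball 0 K) z <-> z = groot K.
  move=> [rK _ _ _ _]; split=> [|->]; last by split=> //; exists [::].
  by case=> _ [[|w p] [_ <-]].
have s_ge : 0 <= s.
  (* Balls of radius 0 are single vertices, hence always isomorphic. *)
  apply: ereal_sup_ubound; exists 0%N => //.
  exists (fun=> groot (class_repr y)); last first.
    split=> // z w; rewrite !inE => /(b0 _ _ cx) -> /(b0 _ _ cx) ->.
    by case: cx cy => _ _ ix _ _ [_ _ iy _ _] /=; rewrite ix iy !andbF.
  split=> [z _|z w|w /(b0 _ _ cy) ->]; first exact/b0.
    by rewrite !inE => /(b0 _ _ cx) -> /(b0 _ _ cx) ->.
  by exists (groot (class_repr x)) => //; exact/b0.
case: s s_le s_ge => [s| |]//; rewrite !lee_fin => sn s0.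
have p0 (z : R) : (0 <= z)%R -> (0 < 1 + z)%R by move=> z0; rewrite ltr_pwDl.
rewrite -EFinD inver gt_eqF ?p0//= lef_pV2 ?posrE ?p0//.
by rewrite lerD2l.
Qed.

(** Every preimage under a local statistic is a union of metric balls: this gives
    continuity, and measurability into any measurable space, at once. *)
Lemma local_stat_open (T : Type) n (S : rootedDigraph -> T) (A : set T) :
  local_stat n S -> open [set x : Gstar R | A (S (class_repr x))].
Proof.
move=> locS; rewrite openE => x /= Ax.
apply/nbhs_ballP; exists (1 + n%:R)^-1%R => /=.
  by rewrite invr_gt0 ltr_pwDl.
move=> y; rewrite Gstar_ballE /= => /gdist_agree xy.
by rewrite -(local_stat_agree locS _ _ xy)//; exact: class_reprP.
Qed.

Lemma local_stat_continuous n (S : rootedDigraph -> R) :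
  local_stat n S -> continuous (fun x : Gstar R => S (class_repr x)).
Proof.
move=> locS; apply/continuousP => A _.
exact: local_stat_open locS.
Qed.

Lemma local_stat_measurable d (Omega : measurableType d)
    (P : probability Omega R) (X : {RV P >-> Gstar R})
    d' (T : measurableType d') n (S : rootedDigraph -> T) :
  local_stat n S -> measurable_fun setT (fun w => S (class_repr (X w))).
Proof.
move=> locS mD A _; rewrite setTI.
have mX : measurable_fun setT X by [].
rewrite -[X in measurable X]setTI.
have -> : (fun w => S (class_repr (X w))) @^-1` A =
   X @^-1` [set x : Gstar R | A (S (class_repr x))] by [].
by apply: mX => //; apply: sub_sigma_algebra; exact: (local_stat_open locS).
Qed.

(** The representative of a class is chosen abstractly; it is only known to be
    isomorphic to the component. *)
Lemma class_repr_component n (T : Type) (S : rootedDigraph -> T)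
    (V : finType) (G : digraph V) (v : V) :
  local_stat n S -> S (class_repr (component_class G v R)) = S (component G v).
Proof.
case=> Siso _.
have cc : connected_locally_finite (component G v) by exact: component_clf.
have cr := class_reprP (component_class G v R).
apply: Siso; [exact: clf_root|exact: clf_arcs_within|exact: clf_arcs_within|].
pose c := ClDigraph (component_clf G v).
have := reprK (\pi_({eq_quot cliso}) c)%qT; move/eqmodP.
by move=> /asboolP.
Qed.

End local_stat_theory.

(** * Passing inequalities to the local limit *)

Section expectation.
Variables (R : realType) (V : nat -> finType) (G : forall n, digraph (V n)).
Variables (d : measure_display) (Omega : measurableType d) (P : probability Omega R).
Variable (X : {RV P >-> Gstar R}).
Hypothesis G_cvg_X : cvg_local G X.

(** An inequality between vertex averages over the finite graphs becomes an
    inequality between expectations in the limit; the pointwise values on a given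
    rooted graph need not be comparable. *)
Lemma local_limit_le m n (f g : rootedDigraph -> \bar R) (M : R) :
  local_stat m f -> local_stat n g ->
  (forall H, 0 <= f H <= M%:E) -> (forall H, 0 <= g H <= M%:E) ->
  (forall k, \sum_(v : V k) fine (f (component (G k) v))
               <= \sum_(v : V k) fine (g (component (G k) v)))%R ->
  \int[P]_w f (class_repr (X w)) <= \int[P]_w g (class_repr (X w)).
Proof.
move=> locf locg fM gM fg.
have expect l (s : rootedDigraph -> \bar R) : local_stat l s ->
    (forall H, 0 <= s H <= M%:E) ->
    exists2 E : R, \int[P]_w s (class_repr (X w)) = E%:E &
    ((\sum_(v : V k) fine (s (component (G k) v))) / #|V k|%:R)%R @[k --> \oo] --> E.
  move=> locs sM.
  have s_fin H : s H = (fine (s H))%:E.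
    have /andP[s0 s1] := sM H; rewrite fineK// fin_numElt.
    by rewrite (lt_le_trans _ s0)// (le_lt_trans s1)// ltry.
  have fine_sM H : (`|fine (s H)| <= M)%R.
    have := sM H; rewrite s_fin !lee_fin /= => /andP[s0 s1].
    by rewrite ger0_norm.
  have locfs := local_stat_comp fine locs.
  exists (\int[P]_w fine (s (class_repr (X w))))%R; last first.
    under eq_fun do under eq_bigr => v _ do
      rewrite -[fine _]/((fine \o s) _) -(class_repr_component R _ v locfs).
    apply: (G_cvg_X (local_stat_continuous locfs)); exists M => x.
    exact: fine_sM.
  rewrite /Rintegral fineK; first by apply: eq_integral => w _; rewrite -s_fin.
  apply: (@integrable_fin_num _ _ _ P setT) => //.
  apply: (@measurable_bounded_integrable _ _ _ P
    (fun w => fine (s (class_repr (X w)))) setT) => //.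
  - by apply: (le_lt_trans (probability_le1 P measurableT)); rewrite ltry.
  - exact: (local_stat_measurable X locfs).
  - exists M; split=> [|N /ltW MN w _ /=]; first exact: num_real.
    exact: le_trans MN.
have [Ef -> cvg_f] := expect _ _ locf fM.
have [Eg -> cvg_g] := expect _ _ locg gM.
rewrite lee_fin; apply: (ler_cvg_to cvg_f cvg_g).
by apply: nearW => k; rewrite ler_wpM2r ?invr_ge0.
Qed.

End expectation.

(** * Truncated degrees and embeddings are local *)

Section statistics.
Variables (R : realType).

Definition root_neighbors (G : rootedDigraph) : set nat := neighbors G (groot G).

(** Roots of large degree contribute nothing, rather than the cap [K]: they are
    isolated in the subgraph of the vertices with at most [K] neighbours. *)
Definition tame_degree (K : nat) (G : rootedDigraph) : \bar R :=
  if root_neighbors G #<= `I_K then counting (root_neighbors G) else 0.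

Lemma within_dist0 (G : rootedDigraph) : within_dist G 0 (groot G).
Proof. by exists [::]. Qed.

Lemma local_tame_degree K : local_stat 1 (tame_degree K).
Proof.
split=> [G H rG aG aH [f fbij [fr fa]]|G cG].
  have e := iso_neighbors aG aH fbij fa rG; rewrite fr in e.
  by rewrite /tame_degree /root_neighbors (card_le_eql e) (counting_eq _ e).
by rewrite /tame_degree /root_neighbors /= (ball_neighbors cG (within_dist0 G)).
Qed.

Lemma local_total_degree : local_stat 1 (total_degree R).
Proof.
split=> [G H rG aG aH [f fbij [fr fa]]|G cG].
  have ei := iso_in aG aH fbij fa rG; rewrite fr in ei.
  have eo := iso_out aG aH fbij fa rG; rewrite fr in eo.
  by rewrite /total_degree (counting_eq _ ei) (counting_eq _ eo).
rewrite /total_degree; congr (_ + _); congr counting;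
  by apply/seteqP; split=> y; rewrite /mkset (ball_arcs cG y (within_dist0 G)).
Qed.

Lemma local_tame_emb (I : finType) (F : digraph I) (r : I) K :
  (forall x y, connect (adj F) x y) ->
  local_stat #|I| (fun G => counting (tame_emb F r K G) : \bar R).
Proof.
move=> conn; split=> [G H rG aG aH GH|G cG].
  exact/counting_eq/tame_emb_iso.
by rewrite tame_emb_ball.
Qed.

End statistics.

(** * The inequality in finite digraphs *)

Section finite_components.
Variables (V : finType) (G : digraph V).

Definition degree (v : V) : nat := #|adj G v|.

Lemma component_arcs (v u w : V) : connect (adj G) v u ->
  arcs (component G v) (enum_rank u) (enum_rank w) = G u w.
Proof.
move=> vu; apply/existsP/idP => [[a /existsP[b /and4P[_ ab]]]|uw].
  by move=> /eqP/ord_inj/enum_rank_inj-> /eqP/ord_inj/enum_rank_inj->.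
by exists u; apply/existsP; exists w; rewrite vu uw !eqxx.
Qed.

Lemma component_neighbors (v u : V) : connect (adj G) v u ->
  neighbors (component G v) (enum_rank u) #= `I_(degree u).
Proof.
move=> vu; apply: card_eq_trans (card_fin_pred (adj G u)).
pose c (w : V) : nat := enum_rank w.
have -> : neighbors (component G v) (enum_rank u) = c @` [set` adj G u].
  apply/seteqP; split=> [y uy|_ [w uw <-]].
    have [w vw yw] : vertex (component G v) y.
      by case/orP: uy => /(clf_arcs_within (component_clf G v))[].
    exists w => //; move: uy; rewrite -yw /neighbors/mkset/adj.
    by rewrite !component_arcs.
  have vw : connect (adj G) v w by apply: connect_trans vu (connect1 uw).
  by rewrite /neighbors/mkset/adj !component_arcs.
apply: inj_card_eq => w w' _ _; exact: (fun e => enum_rank_inj (ord_inj e)).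
Qed.

Variables (R : realType) (I : finType) (F : digraph I) (r : I).
Hypothesis conn : forall x y, connect (adj F) x y.
Hypothesis I_gt1 : (1 < #|I|)%N.

Definition tame_adj K : rel V :=
  fun u w => [&& adj G u w, (degree u <= K)%N & (degree w <= K)%N].

(** Injectivity and the direction of the arcs are forgotten here: what remains is
    a homomorphism of undirected graphs into the vertices of degree at most [K]. *)
Lemma counting_tame_emb_component K v :
  counting (tame_emb F r K (component G v)) <=
  #|[set psi : {ffun I -> V} |
      [forall x, forall y, adj F x y ==> tame_adj K (psi x) (psi y)]
      && (psi r == v)]%SET|%:R%:E :> \bar R.
Proof.
set D := finset _.
rewrite -(counting_II R (card_fin_pred (mem D))).
pose f (psi : {ffun I -> V}) : {ffun I -> nat} := [ffun x => enum_rank (psi x) : nat].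
apply: counting_le; apply: card_le_trans (card_image_le f _).
apply: subset_card_le => phi [[phi_inj vphi aphi phir] dphi].
have /choice[psi psiP] : forall x, exists u,
    connect (adj G) v u /\ (enum_rank u : nat) = phi x.
  by move=> x; have [u vu ux] := vphi x; exists u.
have vpsi x := (psiP x).1; have psiE x := (psiP x).2.
have dpsi x : (degree (psi x) <= K)%N.
  by have := dphi x; rewrite -psiE (card_le_eql (component_neighbors (vpsi x))) card_le_II.
exists (finfun psi); last by apply/ffunP => x; rewrite !ffunE.
rewrite /= inE; apply/andP; split; last first.
  by rewrite ffunE; apply/eqP/enum_rank_inj/ord_inj; rewrite psiE phir.
apply/forallP => x; apply/forallP => y; apply/implyP => xy.
rewrite !ffunE /tame_adj !dpsi !andbT.
by case/orP: xy => /aphi; rewrite -!psiE component_arcs// /adj => ->; rewrite ?orbT.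
Qed.

Lemma tame_degree_component K v : tame_degree R K (component G v) =
  (if (degree v <= K)%N then degree v else 0)%:R%:E.
Proof.
have e := component_neighbors (connect0 (adj G) v).
rewrite /tame_degree /root_neighbors (card_le_eql e) card_le_II.
by case: ifP => // _; exact: counting_II.
Qed.

(** Summing over the root [v] removes the condition on the image of [r], which
    leaves all homomorphisms into [tame_adj K]. *)
Lemma sum_tame_emb_component K :
  (\sum_v fine (mine (counting (tame_emb F r K (component G v))) K%:R%:E)
   <= \sum_v fine (tame_degree R K (component G v) ^+ (#|I| - 1)) :> R)%R.
Proof.
pose D v := [set psi : {ffun I -> V} |
      [forall x, forall y, adj F x y ==> tame_adj K (psi x) (psi y)]
      && (psi r == v)]%SET.
apply: (@le_trans _ _ (\sum_v #|D v|%:R)%R).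
  apply: ler_sum => v _.
  have := counting_tame_emb_component K v; rewrite -/(D v).
  have := counting_ge0 R (tame_emb F r K (component G v)).
  case: (counting _) => [x| |]//; rewrite lee_fin => x0.
  rewrite lee_fin => xD; rewrite -EFin_min/=.
  by rewrite ge_min xD.
rewrite -natr_sum.
apply: (@le_trans _ _ (\sum_v #|tame_adj K v| ^ (#|I|.-1))%:R%R).
  rewrite ler_nat.
  have adj_sym : symmetric (adj F) by move=> x y; rewrite /adj orbC.
  apply: leq_trans (hom_count (tame_adj K) adj_sym conn (ltnW I_gt1)).
  rewrite -sum1_card (partition_big (fun psi : {ffun I -> V} => psi r) predT)//=.
  apply: eq_leq; apply: eq_bigr => v _; rewrite sum1dep_card.
  by apply: eq_card => psi; rewrite !inE.
rewrite natr_sum; apply: ler_sum => v _.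
rewrite tame_degree_component -EFin_expe/= -natrX ler_nat subn1.
rewrite leq_exp2r; last by rewrite -subn1 subn_gt0.
case: (leqP (degree v) K) => [dK|Kd].
  rewrite /degree; apply: subset_leq_card; apply/fintype.subsetP => w.
  by rewrite unfold_in => /and3P[].
(* A vertex of large degree has no neighbour in [tame_adj]; as [0 < #|I| - 1],
   its power vanishes too. *)
rewrite leqn0; apply/eqP/eq_card0 => w; rewrite unfold_in /tame_adj.
by rewrite leqNgt Kd/= andbF.
Qed.

End finite_components.

(** * Removing the truncation *)

Section untruncated.
Variable R : realType.

Lemma finite_nat_bound (T : choiceType) (A : set T) (f : T -> nat) :
  finite_set A -> exists N, forall x, A x -> (f x <= N)%N.
Proof.
move=> /finite_fsetP[X ->]; exists (\max_(x <- X) f x)%N => x xX.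
by apply: (@leq_bigmax_seq _ (X : seq T) xpredT f).
Qed.

Lemma finite_within_dist (G : rootedDigraph) n :
  connected_locally_finite G -> finite_set [set x | within_dist G n x].
Proof.
move=> [_ _ _ _ lf]; elim: n => [|n IH].
  apply: (@sub_finite_set _ _ [set groot G]); last exact: finite_set1.
  by move=> _ [[|x p] [_ <-]].
apply: (@sub_finite_set _ _ ([set groot G] `|`
   \bigcup_(y in [set x | within_dist G n x]) neighbors G y)).
  move=> x [p [pp px pn]]; case/lastP: p => [|p y] in pp px pn.
    by left; rewrite -px.
  right; move: pp px pn; rewrite rcons_path last_rcons size_rcons => /andP[pp ay] <- pn.
  by exists (last (groot G) p) => //; exists p.
rewrite finite_setU; split; first exact: finite_set1.
by apply: bigcup_finite => // y _; exact: lf.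
Qed.

Variables (I : finType) (F : digraph I) (r : I).
Hypothesis conn : forall x y, connect (adj F) x y.

Lemma finite_emb_set G : connected_locally_finite G -> finite_set (emb_set F r G).
Proof.
move=> cG; have [N NP] := finite_nat_bound id (finite_within_dist #|I|.-1 cG).
pose f (psi : {ffun I -> 'I_N.+1}) : {ffun I -> nat} := [ffun x => psi x : nat].
apply: (@sub_finite_set _ _ (range f)); last exact/finite_image/finite_finset.
move=> phi [_ _ aphi phir].
have wd := hom_within_dist conn aphi phir.
exists [ffun x => inord (phi x)] => //; apply/ffunP => x; rewrite !ffunE inordK//.
by rewrite ltnS; apply: NP; exact: wd.
Qed.

(** The finitely many embeddings visit finitely many vertices, all of finite
    degree. *)
Lemma tame_emb_eventually G : connected_locally_finite G ->
  \forall K \near \oo, mine (counting (tame_emb F r K G)) K%:R%:E = emb R F r G.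
Proof.
move=> cG; have finE := finite_emb_set cG.
have [_ _ _ _ lf] := cG.
have /choice[dg dgP] : forall y, exists K, neighbors G y #<= `I_K.
  by move=> y; apply/finite_set_leP; exact: lf.
have [N NP] := finite_nat_bound dg (finite_within_dist #|I|.-1 cG).
exists (maxn N #|` fset_set (emb_set F r G)|) => // K /=.
rewrite geq_max => /andP[NK EK].
have -> : tame_emb F r K G = emb_set F r G.
  apply/seteqP; split=> [phi []//|phi phiE]; split=> // x.
  have [_ _ aphi phir] := phiE.
  apply: card_le_trans (dgP _) _; rewrite card_le_II (leq_trans _ NK)//.
  by apply: NP; exact: (hom_within_dist conn aphi phir).
rewrite /emb -/(emb_set F r G) /counting asboolT// -EFin_min min_l//.
by rewrite ler_nat.
Qed.

Lemma tame_emb_homo G : {homo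
  (fun K => mine (counting (tame_emb F r K G)) K%:R%:E : \bar R) :
  m n / (m <= n)%N >-> m <= n}.
Proof.
move=> m n mn; rewrite le_min !ge_min lee_fin ler_nat mn orbT andbT.
apply/orP; left; apply/counting_le/subset_card_le => phi [phiE dphi].
split=> // x; apply: card_le_trans (dphi x) _; by rewrite card_le_II.
Qed.

Lemma tame_degree_le_total K G : tame_degree R K G <= total_degree R G.
Proof.
rewrite /tame_degree; case: ifP => _; last by rewrite adde_ge0// counting_ge0.
rewrite /total_degree.
have -> : root_neighbors G =
    [set x | arcs G x (groot G)] `|` [set y | arcs G (groot G) y].
  apply/seteqP; split=> y; rewrite /root_neighbors/neighbors/= /adj.
    by case/orP; [right|left].
  by case=> ->; rewrite ?orbT.
exact: (@measureU2 _ _ _ (@counting nat R)).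
Qed.

Lemma tame_degree_ge0 K G : 0 <= tame_degree R K G.
Proof. by rewrite /tame_degree; case: ifP => // _; exact: counting_ge0. Qed.

Lemma tame_degree_le K G : tame_degree R K G <= K%:R%:E.
Proof.
rewrite /tame_degree; case: ifP => [nK|_]; last by rewrite lee_fin.
by apply: (le_trans (counting_le R nK)); rewrite (counting_II R (card_eqxx _)).
Qed.

End untruncated.

Lemma lee_expe (R : realType) (x y : \bar R) n : 0 <= x -> x <= y -> x ^+ n <= y ^+ n.
Proof.
move=> x0 xy; elim: n => [|n IH]; first by rewrite !expe0.
by rewrite !expeS lee_pmul// expe_ge0.
Qed.

Theorem corollary5p4 (R : realType) (h : nat) (h_ge2 : (2 <= h)%N)
    (V : nat -> finType) (G : forall n, digraph (V n))
    (card_V : #|V n| @[n --> \oo] --> \oo)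
    (d : measure_display) (Omega : measurableType d) (P : probability Omega R)
    (X : {RV P >-> Gstar R})
    (G_cvg_X : cvg_local G X)
    (moment : \int[P]_w (total_degree R (class_repr (X w)) ^+ (h - 1)) < +oo)
    (VT : finType) (T : digraph VT) (rT : VT)
    (card_T : #|VT| = h) (T_tree : directed_tree T) :
  \int[P]_w emb R T rT (class_repr (X w)) <=
    2%:E * \int[P]_w (total_degree R (class_repr (X w)) ^+ (h - 1)) /\
  \int[P]_w emb R T rT (class_repr (X w)) < +oo.
Proof.
have [[_ _ conn _] _] := T_tree; subst h.
set mom := \int[P]_w _ in moment *.
have td_ge0 H : 0 <= total_degree R H by rewrite adde_ge0// counting_ge0.
have mom_ge0 : 0 <= mom by apply: integral_ge0 => w _; exact: expe_ge0.
suff emb_le : \int[P]_w emb R T rT (class_repr (X w)) <= mom.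
  split; last exact: le_lt_trans moment.
  by apply: (le_trans emb_le); rewrite mule_natl mule2n leeDl.
pose E K H : \bar R := mine (counting (tame_emb T rT K H)) K%:R%:E.
pose D K H : \bar R := tame_degree R K H ^+ (#|VT| - 1).
have E_ge0 K H : 0 <= E K H by rewrite /E le_min counting_ge0 lee_fin ler0n.
have E_le K H : E K H <= K%:R%:E by rewrite /E ge_min lexx orbT.
have D_ge0 K H : 0 <= D K H by rewrite /D expe_ge0// tame_degree_ge0.
have D_le K H : D K H <= (K%:R ^+ (#|VT| - 1))%:E.
  by rewrite /D EFin_expe lee_expe ?tame_degree_ge0 ?tame_degree_le.
have locE K : local_stat #|VT| (E K).
  exact: (local_stat_comp (fun x => mine x K%:R%:E) (local_tame_emb R rT K conn)).
have locD K : local_stat 1 (D K).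
  exact: (local_stat_comp (fun x => x ^+ (#|VT| - 1)) (local_tame_degree R K)).
have ED K : \int[P]_w E K (class_repr (X w)) <= mom.
  apply: (@le_trans _ _ (\int[P]_w D K (class_repr (X w)))).
    apply: (local_limit_le G_cvg_X (locE K) (locD K) (M := (K%:R + K%:R ^+ (#|VT| - 1))%R)).
    - move=> H; rewrite E_ge0/= (le_trans (E_le K H))// lee_fin lerDl exprn_ge0//.
    - move=> H; rewrite D_ge0/= (le_trans (D_le K H))// lee_fin lerDr//.
    - by move=> k; exact: sum_tame_emb_component.
  apply: ge0_le_integral => //.
  - exact: (local_stat_measurable X (locD K)).
  - exact: (local_stat_measurable X (local_stat_comp
      (fun x => x ^+ (#|VT| - 1)) (local_total_degree R))).
  - by move=> w _; rewrite lee_expe ?tame_degree_ge0 ?tame_degree_le_total.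
have lim_E w : limn (fun K => E K (class_repr (X w))) = emb R T rT (class_repr (X w)).
  apply/cvg_lim => //; apply: cvg_near_cst.
  exact: tame_emb_eventually (class_reprP _).
under eq_integral do rewrite -lim_E.
have cvg_E : \int[P]_w E K (class_repr (X w)) @[K --> \oo] -->
    \int[P]_w limn (fun K => E K (class_repr (X w))).
  apply: cvg_monotone_convergence => //.
  - by move=> K; exact: (local_stat_measurable X (locE K)).
  - by move=> w _; exact: tame_emb_homo.
rewrite -(cvg_lim _ cvg_E)//; apply: lime_le; first by apply/cvg_ex; eexists; exact: cvg_E.
exact: nearW.
Qed.
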